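(* If $L$ is a Latin square of even order $n>2$, then $$E_3^{\mathrm{ev}} + E_5^{\mathrm{ev}} + \cdots + E_{n-1}^{\mathrm{ev}} \equiv E_1^{\mathrm{ev}}+ E_2^{\mathrm{ev}} + E_4^{\mathrm{ev}} + E_6^{\mathrm{ev}} + \cdots + E_n^{\mathrm{ev}} \equiv 0 \pmod 2,$$ where the first sum is over all odd indices from $3$ to $n-1$, and the second sum consists of $E_1^{\mathrm{ev}}$ together with the terms for all even indices from $2$ to $n$.
   Context: A Latin square of order $n$ is an $n\times n$ matrix with symbols from $[n]=\{1,\dots,n\}$ in which each symbol appears exactly once in each row and exactly once in each column. A diagonal of $L$ is a selection of $n$ entries (cells), exactly one from each row and exactly one from each column; it thus consists of the cells $(i,\sigma(i))$, $i\in[n]$, for a permutation $\sigma$ of $[n]$, and it is called even if $\sigma$ is an even permutation. $E_i^{\mathrm{ev}}=E_i^{\mathrm{ev}}(L)$ is the number of even diagonals of $L$ on which exactly $i$ distinct symbols appear. *)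

(* Defs.v *)
From mathcomp Require Import all_boot all_fingroup all_algebra.

Set Implicit Arguments.
Unset Strict Implicit.
Unset Printing Implicit Defensive.

(* Rows, columns and symbols are all indexed by 'I_n, i.e. the symbol set
   {1, ..., n} is renamed to {0, ..., n - 1}. *)
Definition latin_square (n : nat) (L : 'M['I_n]_n) : Prop :=
  (forall i k : 'I_n, exists! j : 'I_n, L i j = k) /\
  (forall j k : 'I_n, exists! i : 'I_n, L i j = k).

(* A diagonal is encoded by the permutation s whose cells are (i, s i). *)
Definition diag_symbols (n : nat) (L : 'M['I_n]_n) (s : 'S_n) : {set 'I_n} :=
  [set L i (s i) | i : 'I_n].

Definition E_ev (n : nat) (L : 'M['I_n]_n) (k : nat) : nat :=
  #|[set s : 'S_n | ~~ odd_perm s & #|diag_symbols L s| == k]|.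

(* Main.v *)
Require Import Defs.
From mathcomp Require Import all_boot all_fingroup all_algebra.
From mathcomp Require Import alt zify.

Set Implicit Arguments.
Unset Strict Implicit.
Unset Printing Implicit Defensive.

Import GRing.Theory.

(** The total number of even diagonals is n!/2, which is even once n >= 4, so
    it is enough to show that the number of even diagonals carrying an odd
    number of symbols has the same parity as E_1.

    As n is even, a diagonal carries an odd number of symbols exactly when it
    misses an odd number of them. Hence, modulo 2, the diagonals to be counted
    can be replaced by the pairs (s, k) in which the even diagonal s misses the
    symbol k ([odd_sum]), and these pairs can be counted symbol by symbol. The
    cells containing k form a permutation p k, and s misses k if and only if
    s * (p k)^-1 is a derangement; its sign is that of p k. So the count is
    e * D_0 + (n - e) * D_1, where e is the number of symbols k with p k even
    and D_0, D_1 are the numbers of even and odd derangements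
    ([card_even_avoiding]).

    For even n the number D_0 + D_1 of derangements is odd
    ([odd_card_derangements]), and n - e has the parity of e, so the count has
    the parity of e. Finally e = E_1, because the diagonals carrying a single
    symbol are exactly the permutations p k ([E_ev_1]). *)

Lemma sum_card_fibres (T : finType) (A : {set T}) (f : T -> nat)
    (P : pred nat) (m k : nat) :
  \sum_(m <= i < k | P i) #|[set x in A | f x == i]|
    = #|[set x in A | (m <= f x < k) && P (f x)]|.
Proof.
under eq_bigr => i _ do rewrite -sum1dep_card.
rewrite (exchange_big_dep (mem A)) /=; last by move=> i x _ /andP[].
rewrite -sum1dep_card big_mkcondr; apply: eq_bigr => x xA.
under eq_bigl => i do rewrite xA /=.
rewrite sum1_count (@eq_count _ _ (fun i => P (f x) && pred1 (f x) i)); last first.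
  by move=> i /=; rewrite eq_sym; case: eqP => [->|_]; rewrite ?andbF.
rewrite -mem_index_iota; case: (P (f x)) => /=.
  by rewrite andbT count_uniq_mem ?iota_uniq //; case: (f x \in _).
by rewrite andbF count_pred0.
Qed.

Lemma odd_sum (T : finType) (A : {set T}) (f : T -> nat) :
  odd (\sum_(x in A) f x) = odd #|[set x in A | odd (f x)]|.
Proof.
rewrite -sum1dep_card big_mkcondr /=.
by elim/big_rec2: _ => // x a b _ e; rewrite !oddD e; case: (odd (f x)).
Qed.

Lemma sum_nat_of_bool (T : finType) (P : pred T) :
  \sum_x (P x : nat) = #|[set x | P x]|.
Proof.
by rewrite -sum1dep_card [RHS]big_mkcond; apply: eq_bigr => x _; case: (P x).
Qed.

Definition derangements (n : nat) (b : bool) : {set 'S_n} :=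
  [set s : 'S_n | [forall i, s i != i] & odd_perm s == b].

(** Modulo 2 signs disappear, so the number of derangements is the determinant
    of J - 1, where J is the all-ones matrix; for even n this matrix squares to
    the identity because J ^ 2 = n J = 0. *)
Lemma odd_card_derangements (n : nat) :
  ~~ odd n -> odd (#|derangements n false| + #|derangements n true|).
Proof.
move=> n_even.
have char2 : 2 \in [pchar 'F_2]%R by exact: pchar_Fp.
pose A : 'M['F_2]_n := (\matrix_(i, j) (i != j)%:R)%R.
have A2 : (A *m A = 1%:M)%R.
  apply/matrixP => i j; rewrite !mxE.
  under eq_bigr => k _ do rewrite !mxE -natrM mulnb.
  rewrite -natr_sum sum_nat_of_bool -(GRing.natr_mod_pchar char2) modn2.
  rewrite (_ : [set k | _] = ~: [set i; j]); last first.
    by apply/setP => k; rewrite !inE negb_or eq_sym.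
  have := cardsC [set i; j]; rewrite cards2 card_ord => /(congr1 odd).
  by rewrite oddD (negbTE n_even); case: eqP; case: (odd #|_|).
have detA : (\det A = (#|derangements n false| + #|derangements n true|)%:R)%R.
  transitivity (\sum_(s : 'S_n) ([forall i, s i != i] : nat)%:R : 'F_2)%R.
    apply: eq_bigr => s _; rewrite oppr_pchar2 // expr1n mul1r.
    case: (boolP [forall _, _]) => [/forallP der|].
      by rewrite big1 // => i _; rewrite mxE eq_sym der.
    rewrite negb_forall => /existsP[i]; rewrite negbK => /eqP si.
    by rewrite (bigD1 i) //= mxE si eqxx mul0r.
  rewrite -natr_sum sum_nat_of_bool; congr (_%:R)%R.
  rewrite -(cardsID [set s : 'S_n | odd_perm s]) addnC.
  by congr (_ + _); apply: eq_card => s; rewrite !inE;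
    case: (odd_perm s); rewrite ?andbT ?andbF.
(* An element of F_2 whose square is 1 is nonzero. *)
have := congr1 determinant A2; rewrite det_mulmx det1 detA -natrM => /eqP.
rewrite -(GRing.natr_mod_pchar char2) modn2 oddM andbb.
by case: (odd _).
Qed.

(** The row condition makes the column of the symbol k a function of the row,
    and the column condition makes this function injective. *)
Lemma latin_symbol_perms (n : nat) (L : 'M['I_n]_n) :
  latin_square L ->
  exists p : 'I_n -> 'S_n, forall k i j, (L i j == k) = (j == p k i).
Proof.
move=> [rowL colL].
have /fin_all_exists[p pP] k :
    exists p : 'S_n, forall i j, (L i j == k) = (j == p i).
  have /fin_all_exists[f fP] i : exists j, L i j = k /\ forall j', L i j' = k -> j = j'.
    by have [j [Lij uj]] := rowL i k; exists j.
  have f_inj : injective f.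
    move=> i i' eq_f; have [i0 [_ ui0]] := colL (f i) k.
    by rewrite -(ui0 i (fP i).1) -(ui0 i') // eq_f (fP i').1.
  exists (perm f_inj) => i j; rewrite permE.
  by apply/eqP/eqP => [/(fP i).2|->]; last exact: (fP i).1.
by exists p.
Qed.

Section SymbolPermutations.

Variables (n : nat) (L : 'M['I_n]_n) (p : 'I_n -> 'S_n).
Hypothesis pP : forall k i j, (L i j == k) = (j == p k i).

(** A diagonal with a single symbol k is forced to be p k, the set of all cells
    containing k. *)
Lemma E_ev_1 : 0 < n -> E_ev L 1 = #|[set k | ~~ odd_perm (p k)]|.
Proof.
move=> n_gt0; pose i0 := Ordinal n_gt0.
have p_inj : injective p.
  move=> k k' eq_p; have /eqP <- : L i0 (p k i0) == k by rewrite pP.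
  by apply/eqP; rewrite pP eq_p.
rewrite /E_ev -(card_imset _ p_inj); apply: eq_card => s; rewrite inE.
apply/andP/imsetP => [[s_even /cards1P[k symE]]|[k]].
  have sE : s = p k.
    apply/permP => i; apply/eqP; rewrite -pP -in_set1 -symE.
    exact: imset_f.
  by exists k => //; rewrite inE -sE.
rewrite inE => pk_even ->; split=> //; apply/cards1P; exists k.
apply/setP => k'; rewrite inE; apply/imsetP/eqP => [[i _ ->]|->].
  by apply/eqP; rewrite pP.
by exists i0 => //; apply/esym/eqP; rewrite pP.
Qed.

Lemma symbol_notin_diag (s : 'S_n) (k : 'I_n) :
  (k \notin diag_symbols L s) = [forall i, (s * (p k)^-1)%g i != i].
Proof.
apply/idP/forallP => [k_notin i|disj].
  apply: contra k_notin => /eqP; rewrite permM => /esym/(canLR (permKV _)) si.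
  by apply/imsetP; exists i => //; apply/esym/eqP; rewrite pP si.
apply/imsetP => -[i _ /esym/eqP]; rewrite pP => /eqP si.
by have := disj i; rewrite permM si permK eqxx.
Qed.

Lemma card_even_avoiding (k : 'I_n) :
  #|[set s : 'S_n | ~~ odd_perm s & k \notin diag_symbols L s]|
    = #|derangements n (odd_perm (p k))|.
Proof.
rewrite -(card_imset _ (mulIg (p k)^-1%g)); apply: eq_card => t.
rewrite inE; apply/imsetP/andP => [[s]|[t_der /eqP t_odd]].
  rewrite inE symbol_notin_diag => /andP[/negbTE s_even s_der] ->.
  by rewrite odd_permM odd_permV s_even.
exists (t * p k)%g; last by rewrite mulgK.
by rewrite inE symbol_notin_diag mulgK odd_permM t_odd addbb.
Qed.

(** Both sides count the pairs formed by an even diagonal and a symbol missing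
    from it: by diagonal on the left, by symbol on the right. *)
Lemma sum_missing_symbols :
  \sum_(s : 'S_n | ~~ odd_perm s) #|~: diag_symbols L s|
    = \sum_k #|derangements n (odd_perm (p k))|.
Proof.
under [LHS]eq_bigr => s _ do rewrite -sum1_card.
rewrite (exchange_big_dep xpredT) //=; apply: eq_bigr => k _.
rewrite -card_even_avoiding -sum1dep_card.
by apply: eq_bigl => s; rewrite inE.
Qed.

End SymbolPermutations.

(** Modulo 2 the count is e * D_0 + (n - e) * D_1 = e * (D_0 + D_1) = e, where
    e is the number of symbols whose permutation is even. *)
Lemma odd_card_odd_diagonals (n : nat) (L : 'M['I_n]_n) :
  ~~ odd n -> 0 < n -> latin_square L ->
  odd #|[set s : 'S_n | ~~ odd_perm s & odd #|diag_symbols L s|]|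
    = odd (E_ev L 1).
Proof.
move=> n_even n_gt0 /latin_symbol_perms[p pP].
pose evens := [set s : 'S_n | ~~ odd_perm s].
have miss s : odd #|~: diag_symbols L s| = odd #|diag_symbols L s|.
  have := cardsC (diag_symbols L s); rewrite card_ord => /(congr1 odd).
  by rewrite oddD (negbTE n_even); do 2!case: (odd _).
transitivity (odd (\sum_(s in evens) #|~: diag_symbols L s|)).
  rewrite odd_sum; congr (odd _); apply: eq_card => s.
  by rewrite !inE miss.
rewrite (eq_bigl (fun s => ~~ odd_perm s)); last by move=> s; rewrite inE.
rewrite (sum_missing_symbols pP) (E_ev_1 pP) //.
set e := [set k | ~~ _].
have -> : \sum_k #|derangements n (odd_perm (p k))|
    = #|e| * #|derangements n false| + #|~: e| * #|derangements n true|.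
  rewrite (bigID (mem e)) /=; congr (_ + _).
    rewrite -sum_nat_const; apply: eq_bigr => k.
    by rewrite inE => /negbTE->.
  rewrite -sum_nat_const; apply: eq_big => [k|k]; first by rewrite !inE.
  by rewrite !inE negbK => ->.
have := odd_card_derangements n_even.
have := cardsC e; rewrite card_ord => /(congr1 odd).
rewrite !oddD !oddM (negbTE n_even).
by do 4!case: (odd _).
Qed.

Theorem theorem42 (n : nat) (L : 'M['I_n]_n)
    (n_even : ~~ odd n) (n_gt2 : 2 < n) (latinL : latin_square L) :
  \sum_(3 <= i < n | odd i) E_ev L i
    = E_ev L 1 + \sum_(2 <= i < n.+1 | ~~ odd i) E_ev L i %[mod 2] /\
  E_ev L 1 + \sum_(2 <= i < n.+1 | ~~ odd i) E_ev L i = 0 %[mod 2].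
Proof.
have n_gt0 : 0 < n by exact: ltn_trans n_gt2.
have n_ge4 : 3 < n by move: n_even; rewrite ltn_neqAle n_gt2; case: eqP => // <-.
pose c (s : 'S_n) := #|diag_symbols L s|.
pose evens := [set s : 'S_n | ~~ odd_perm s].
have c_gt0 s : 0 < c s.
  by apply/card_gt0P; exists (L (Ordinal n_gt0) (s (Ordinal n_gt0))); exact: imset_f.
have c_le s : c s <= n by rewrite -[leqRHS]card_ord max_card.
have E_evE i : E_ev L i = #|[set s in evens | c s == i]|.
  by apply: eq_card => s; rewrite !inE.
have even_total : odd #|evens| = false.
  have -> : #|evens| = #|('Alt_('I_n))%g|.
    by apply: eq_card => s; rewrite inE Alt_even.
  have := @card_Alt 'I_n; rewrite card_ord => /(_ (ltnW n_gt2)).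
  (* n! is a multiple of 4! = 24, so its half is even. *)
  rewrite -(bin_fact n_ge4) mulnCA => /(congr1 (fun m => odd m./2)).
  by rewrite mul2n doubleK -[4`!]/(12).*2 -doubleMl doubleK oddM.
under eq_bigr => i _ do rewrite E_evE.
under [X in _ + X]eq_bigr => i _ do rewrite E_evE.
rewrite !sum_card_fibres.
set lo := #|_|; set ev := #|_|.
have oddE : #|[set s in evens | odd (c s)]| = E_ev L 1 + lo.
  rewrite E_evE -(cardsID [set s | c s == 1]).
  congr (_ + _); apply: eq_card => s; rewrite !inE.
    by case: (c s =P 1) => [->|_]; rewrite ?andbT ?andbF.
  by case: (odd_perm s) => //=; have := c_gt0 s; have := c_le s; lia.
have totalE : #|evens| = E_ev L 1 + lo + ev.
  rewrite -oddE -(cardsID [set s | odd (c s)]).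
  congr (_ + _); apply: eq_card => s; rewrite !inE //.
  by case: (odd_perm s) => //=; have := c_gt0 s; have := c_le s; lia.
(* The diagonals counted by oddE include the E_1 ones, and have their parity. *)
have odd_lo : odd lo = false.
  have := odd_card_odd_diagonals n_even n_gt0 latinL.
  rewrite (_ : [set s | _] = [set s in evens | odd (c s)]).
    by rewrite oddE oddD; do 2!case: (odd _).
  by apply/setP => s; rewrite !inE.
have odd_ev : odd (E_ev L 1 + ev) = false.
  by move: even_total; rewrite totalE addnAC oddD odd_lo addbF.
by rewrite !modn2 odd_lo odd_ev.
Qed.
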